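(* For every nonnegative integer $n$, \[ \frac{(-1)^{n+1}}{n!}\,\mathrm{Ls}_{n+1}\!\left(\frac{\pi}{3}\right) \;=\; {}_{n+2}F_{n+1}\!\left(\begin{matrix}\frac12,\ldots,\frac12\\ \frac32,\ldots,\frac32\end{matrix};\,\frac14\right) \;=\; \sum_{k=0}^\infty \frac{2^{-4k}}{(2k+1)^{n+1}}\binom{2k}{k}, \] where the hypergeometric function has $n+2$ upper parameters all equal to $\frac12$ and $n+1$ lower parameters all equal to $\frac32$. Consequently, for complex $s$ with $|s|<1$, \[ -\sum_{n=0}^\infty \mathrm{Ls}_{n+1}\!\left(\frac{\pi}{3}\right)\frac{s^n}{n!} \;=\; \frac{1}{s+1}\,{}_2F_1\!\left(\begin{matrix}\frac12,\ \frac{s}{2}+\frac12\\ \frac{s}{2}+\frac32\end{matrix};\,\frac14\right) \;=\; \sum_{k=0}^\infty \frac{2^{-4k}}{2k+1+s}\binom{2k}{k}. \]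
   Context: For integers $n\ge 1$ and real $\sigma$, the log-sine integral is $\mathrm{Ls}_n(\sigma) := -\int_0^{\sigma}\log^{n-1}\left|2\sin\frac{\theta}{2}\right|\,\mathrm{d}\theta$. ${}_pF_q$ denotes the generalized hypergeometric series $\sum_{k\ge0}\frac{(a_1)_k\cdots(a_p)_k}{(b_1)_k\cdots(b_q)_k}\frac{z^k}{k!}$ with Pochhammer symbols $(a)_k$. *)

(* Defs.v *)
From Stdlib Require Import Reals List Factorial Arith.
From Coquelicot Require Import Coquelicot.
Open Scope R_scope.

(* Log-sine integral  Ls_n(sigma) = - int_0^sigma log^(n-1) |2 sin(theta/2)| dtheta.
   The integrand is singular at theta = 0 (for n >= 2), so the integral is taken as
   the improper (generalized Riemann) integral from 0^+ to sigma. Intended for n >= 1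
   and sigma > 0. *)
Definition Ls (n : nat) (sigma : R) : R :=
  - RInt_gen (fun theta => (ln (Rabs (2 * sin (theta / 2)))) ^ (n - 1))
      (at_right 0) (at_point sigma).

Fixpoint poch (a : C) (k : nat) : C :=
  match k with
  | O => 1%C
  | S k' => (poch a k' * (a + RtoC (INR k')))%C
  end.

Definition prod_poch (l : list C) (k : nat) : C :=
  fold_right (fun a acc => (poch a k * acc)%C) 1%C l.

Definition hyp_term (us ls : list C) (z : C) (k : nat) : C :=
  (prod_poch us k / prod_poch ls k * pow_n z k / RtoC (INR (fact k)))%C.

Definition is_pFq (us ls : list C) (z v : C) : Prop :=
  is_series (hyp_term us ls z) v.

(* Main.v *)
(* Put c_k = binom(2k,k) / 16^k and Q_m(x) = sum_k c_k x^k / (2k+1)^m, so that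
   Q_m + 2 x Q_m' = Q_(m-1), i.e. d(u Q_m(u^2))/du = Q_(m-1)(u^2).  With
   u = 2 sin(t/2), repeated integration by parts gives
     int_0^(pi/3) (-ln u)^n / n! * Q_0(u^2) cos(t/2) dt = Q_(n+1)(1),
   and Q_0(u^2) cos(t/2) = 1 by the differential equation of Q_0.
   For the generating function, cutting the geometric expansion of 1/(2k+1+s) in
   powers of -s/(2k+1) after N terms leaves a remainder that is O(|s|^N) after
   summation over k, so no exchange of infinite sums is needed. *)
Require Import Defs.
From Stdlib Require Import Reals List Factorial Arith Lra Lia.
From Coquelicot Require Import Coquelicot.
Open Scope R_scope.

(** * Central binomial coefficients, the power series [Q m], and [Q 0] in closed form *)

Definition cbin (k : nat) : R := / 2 ^ (4 * k) * Binomial.C (2 * k) k.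

Lemma cbin_0 : cbin 0 = 1.
Proof. unfold cbin, Binomial.C; simpl; field. Qed.

(** This is binom(2k+2, k+1) / binom(2k, k) = 2 (2k+1) / (k+1), divided by 16. Positivity, decay,
    the differential equation of [Q 0] and the link to Pochhammer symbols all come from it. *)
Lemma cbin_S (k : nat) : 4 * INR (S k) * cbin (S k) = (INR k + 1 / 2) * cbin k.
Proof.
  unfold cbin, Binomial.C.
  replace (2 * S k - S k)%nat with (S k) by lia.
  replace (2 * k - k)%nat with k by lia.
  replace (2 * S k)%nat with (S (S (2 * k))) by lia.
  replace (4 * S k)%nat with (4 + 4 * k)%nat by lia.
  rewrite pow_add, !fact_simpl, !mult_INR, !S_INR, mult_INR; simpl (INR 2).
  pose proof (INR_fact_neq_0 k); pose proof (pos_INR k).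
  pose proof (pow_nonzero 2 (4 * k) ltac:(lra)).
  field; repeat split; lra.
Qed.

Lemma cbin_pos (k : nat) : 0 < cbin k.
Proof.
  induction k as [|k IH]; [rewrite cbin_0; lra|].
  pose proof (cbin_S k); pose proof (pos_INR k); rewrite S_INR in *; nra.
Qed.

(** Successive ratios are (k + 1/2) / (4 (k+1)), hence at most 1/4. This puts the radius of
    convergence of every [Q m] at 4 or more, well beyond the point 1. *)
Lemma cbin_le (k : nat) : cbin k * 4 ^ k <= 1.
Proof.
  induction k as [|k IH]; [rewrite cbin_0; simpl; lra|].
  pose proof (cbin_S k); pose proof (pos_INR k); rewrite S_INR in *.
  pose proof (cbin_pos k); pose proof (cbin_pos (S k)).
  assert (cbin (S k) * 4 <= cbin k) by nra.
  pose proof (pow_lt 4 k ltac:(lra)); simpl; nra.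
Qed.

Definition qcoef (m k : nat) : R := cbin k / (2 * INR k + 1) ^ m.

(** In closed form [Q 0 x] is (1 - x/4)^(-1/2), and u [Q 1](u^2) is 2 arcsin(u/2). *)
Definition Q (m : nat) : R -> R := PSeries (qcoef m).

Lemma qcoef_bound (m k : nat) : 0 < qcoef m k <= cbin k.
Proof.
  pose proof (cbin_pos k); pose proof (pos_INR k).
  assert (1 <= (2 * INR k + 1) ^ m) by (apply pow_R1_Rle; lra).
  unfold qcoef; split; [apply Rdiv_lt_0_compat; lra|].
  apply Rle_div_l; nra.
Qed.

Lemma qcoef_S (m k : nat) : (2 * INR k + 1) * qcoef (S m) k = qcoef m k.
Proof.
  pose proof (pos_INR k); unfold qcoef; simpl; field.
  split; [apply pow_nonzero|]; lra.
Qed.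

Lemma qcoef_radius (m : nat) (x : R) : Rabs x < 4 ->
  Rbar_lt (Rabs x) (CV_radius (qcoef m)).
Proof.
  intros Hx; apply Rbar_lt_le_trans with 4; [exact Hx|].
  apply (proj1 (CV_radius_bounded (qcoef m))); exists 1; intros k.
  destruct (qcoef_bound m k); pose proof (pow_lt 4 k ltac:(lra)).
  pose proof (cbin_le k); rewrite Rabs_pos_eq; nra.
Qed.

Lemma is_derive_Q (m : nat) (x : R) : Rabs x < 4 ->
  is_derive (Q m) x (PSeries (PS_derive (qcoef m)) x).
Proof. intros Hx; apply is_derive_PSeries, qcoef_radius, Hx. Qed.

Lemma ex_pseries_qcoef (m : nat) (x : R) : Rabs x < 4 -> ex_pseries (qcoef m) x.
Proof. intros Hx; apply CV_radius_inside, qcoef_radius, Hx. Qed.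

Lemma ex_pseries_dqcoef (m : nat) (x : R) : Rabs x < 4 ->
  ex_pseries (PS_derive (qcoef m)) x.
Proof.
  intros Hx; apply CV_radius_inside; rewrite CV_radius_derive.
  apply qcoef_radius, Hx.
Qed.

(** The operator 1 + 2 x d/dx multiplies the coefficient of x^k by 2k + 1, which is [qcoef_S]. *)
Lemma Q_step (m : nat) (x : R) : Rabs x < 4 ->
  Q (S m) x + 2 * x * PSeries (PS_derive (qcoef (S m))) x = Q m x.
Proof.
  intros Hx; unfold Q.
  rewrite Rmult_assoc, <- PSeries_incr_1, <- PSeries_scal, <- PSeries_plus.
  - apply PSeries_ext; intros [|k]; rewrite <- qcoef_S;
      unfold PS_plus, PS_scal, PS_incr_1, PS_derive, plus, scal, zero;
      simpl (AbelianMonoid.zero _); simpl; unfold mult; simpl; [|]; try ring.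
  - apply ex_pseries_qcoef, Hx.
  - apply ex_pseries_scal; [apply Rmult_comm|].
    apply ex_pseries_incr_1, ex_pseries_dqcoef, Hx.
Qed.

(** The coefficient of x^k on both sides of [E] gives 4 (k+1) c_(k+1) = k c_k + c_k / 2, which is
    [cbin_S]. *)
Lemma Q0_ode (x : R) : Rabs x < 4 ->
  (4 - x) * PSeries (PS_derive (qcoef 0)) x = Q 0 x / 2.
Proof.
  intros Hx; unfold Q.
  assert (E : 4 * PSeries (PS_derive (qcoef 0)) x =
    x * PSeries (PS_derive (qcoef 0)) x + / 2 * PSeries (qcoef 0) x); [|lra].
  rewrite <- PSeries_incr_1, <- !PSeries_scal, <- PSeries_plus.
  - apply PSeries_ext; intros k; pose proof (cbin_S k) as E.
    unfold PS_plus, PS_scal, PS_incr_1, PS_derive, qcoef, plus, scal, zero, mult.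
    destruct k as [|k]; simpl in *; unfold mult; simpl; lra.
  - apply ex_pseries_incr_1, ex_pseries_dqcoef, Hx.
  - apply ex_pseries_scal; [apply Rmult_comm|].
    apply ex_pseries_qcoef, Hx.
Qed.

Lemma Q_0 (m : nat) : Q m 0 = 1.
Proof.
  unfold Q; rewrite PSeries_0; unfold qcoef; rewrite cbin_0; simpl.
  rewrite Rmult_0_r, Rplus_0_l, pow1; field.
Qed.

(** The constant coefficient is positive and the remaining terms are nonnegative. The sign selects
    the right square root in [Q0_cos]. *)
Lemma Q_pos (m : nat) (x : R) : 0 <= x < 4 -> 0 < Q m x.
Proof.
  intros Hx; unfold Q.
  rewrite PSeries_decr_1 by (apply ex_pseries_qcoef; rewrite Rabs_pos_eq; lra).
  destruct (qcoef_bound m 0).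
  enough (0 <= PSeries (PS_decr_1 (qcoef m)) x) by nra.
  rewrite <- (Rmult_0_l (Series (fun _ => 0))), <- Series_scal_l.
  apply Series_le.
  - intros k; rewrite Rmult_0_l; split; [lra|].
    destruct (qcoef_bound m (S k)); unfold PS_decr_1.
    apply Rmult_le_pos; [lra|apply pow_le; lra].
  - apply ex_pseries_R.
    apply (ex_pseries_decr_1 (qcoef m)).
    + destruct (Req_dec x 0); [now left|right].
      exists (/ x); unfold mult, one; simpl; field; auto.
    + apply ex_pseries_qcoef; rewrite Rabs_pos_eq; lra.
Qed.

(* The ODE [(4 - x) P' = P / 2] makes [P^2 (4 - x)] constant. *)
Lemma Q0_sqr (x : R) : 0 <= x < 4 -> Q 0 x ^ 2 * (4 - x) = 4.
Proof.
  intros [[Hx|<-] Hx4]; [|rewrite Q_0; ring].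
  transitivity (Q 0 0 ^ 2 * (4 - 0)); [|rewrite Q_0; ring].
  symmetry; apply (eq_is_derive (fun t => Q 0 t ^ 2 * (4 - t)) 0 x); [|exact Hx].
  intros t Ht; assert (Rabs t < 4) by (rewrite Rabs_pos_eq; lra).
  pose proof (is_derive_Q 0 t H) as D; pose proof (Q0_ode t H) as E.
  evar_last.
  - apply (is_derive_mult (fun t => Q 0 t ^ 2) (fun t => 4 - t)).
    + apply is_derive_pow, D.
    + auto_derive; [exact I|reflexivity].
    + apply Rmult_comm.
  - unfold plus, mult, zero; simpl.
    replace (Q 0 t) with (2 * ((4 - t) * PSeries (PS_derive (qcoef 0)) t)) by lra.
    ring.
Qed.

(** At x = 4 sin^2(t/2) one has 4 - x = 4 cos^2(t/2), so [Q0_sqr] makes the square of the product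
    equal to 1; both factors are positive. *)
Lemma Q0_cos (t : R) : 0 < t < PI / 2 -> Q 0 ((2 * sin (t / 2)) ^ 2) * cos (t / 2) = 1.
Proof.
  intros Ht; pose proof PI_RGT_0.
  assert (Hc : 0 < cos (t / 2)) by (apply cos_gt_0; lra).
  pose proof (sin2_cos2 (t / 2)) as E; unfold Rsqr in E.
  assert (Hx : 0 <= (2 * sin (t / 2)) ^ 2 < 4) by (split; [apply pow2_ge_0|nra]).
  pose proof (Q0_sqr _ Hx) as S; pose proof (Q_pos 0 _ Hx) as P.
  set (q := Q 0 _) in *.
  assert (E2 : (q * cos (t / 2)) ^ 2 = 1).
  { transitivity (q ^ 2 * (4 - (2 * sin (t / 2)) ^ 2) / 4); [|lra].
    replace ((q * cos (t / 2)) ^ 2) with (q ^ 2 * (cos (t / 2) * cos (t / 2))) by ring.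
    replace (cos (t / 2) * cos (t / 2)) with (1 - sin (t / 2) * sin (t / 2)) by lra.
    field. }
  pose proof (Rmult_lt_0_compat _ _ P Hc); nra.
Qed.

(** * Improper integrals at 0 and the logarithmic moments of [Q j] *)

Lemma at_right_Ioo (a b : R) : a < b -> at_right a (fun x => a < x < b).
Proof.
  intros Hab; apply filter_and.
  - exists (mkposreal 1 Rlt_0_1); intros y _ Hy; exact Hy.
  - apply filter_le_within, (open_lt b a Hab).
Qed.

(** The fundamental theorem of calculus on [x, b], followed by x -> a from the right. Only a limit
    of [F] at [a] is required, so [f] may be singular there. *)
Lemma is_RInt_gen_at_right (F f : R -> R) (a b l : R) : a < b ->
  (forall x, a < x <= b -> is_derive F x (f x)) ->
  (forall x, a < x <= b -> continuous f x) ->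
  filterlim F (at_right a) (locally l) ->
  is_RInt_gen f (at_right a) (at_point b) (F b - l).
Proof.
  intros Hab D Cf HF P HP.
  assert (HFb : filterlim (fun x => F b - F x) (at_right a) (locally (F b - l))).
  { apply (filterlim_comp_2 (G := locally (F b)) (H := locally (- l)) (fun _ => F b) (fun x => - F x) Rplus).
    - apply filterlim_const.
    - apply (filterlim_comp _ _ _ F Ropp _ (locally l)); [exact HF|].
      apply (filterlim_opp l).
    - apply (filterlim_plus (F b) (- l)). }
  apply (Filter_prod _ _ _ (fun x => (a < x /\ x < b) /\ P (F b - F x)) (fun y => y = b)).
  - apply filter_and; [exact (at_right_Ioo a b Hab)|exact (HFb P HP)].
  - reflexivity.
  - intros x y [[Hax Hxb] HPx] ->; exists (F b - F x); split; [|exact HPx].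
    simpl; apply (is_RInt_derive F f); rewrite Rmin_left, Rmax_right by lra;
      intros t Ht; [apply D|apply Cf]; lra.
Qed.

(** With x = - ln u, the Taylor bound e^x >= x^(m+1) / (m+1)! gives u x^m <= (m+1)! / x, and x tends
    to infinity. *)
Lemma filterlim_mul_ln_pow (m : nat) :
  filterlim (fun u => u * (- ln u) ^ m) (at_right 0) (locally 0).
Proof.
  apply (filterlim_le_le (fun _ => 0) _ (fun u => INR (fact (S m)) * / - ln u) 0).
  - generalize (at_right_Ioo 0 1 Rlt_0_1); apply filter_imp; intros u [Hu0 Hu1].
    assert (Hx : 0 < - ln u).
    { pose proof (ln_increasing u 1 Hu0 Hu1); rewrite ln_1 in *; lra. }
    set (x := - ln u) in *.
    pose proof (pow_lt x m Hx) as Hp.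
    split; [nra|].
    assert (E : x ^ S m / INR (fact (S m)) <= exp x).
    { eapply Rle_trans; [|apply (exp_ge_taylor x (S m)); lra].
      rewrite tech5.
      enough (0 <= sum_f_R0 (fun k => x ^ k / INR (fact k)) m) by lra.
      apply cond_pos_sum; intros k; pose proof (INR_fact_lt_0 k).
      apply Rdiv_le_0_compat; [apply pow_le|]; lra. }
    assert (Ex : exp x * u = 1).
    { unfold x; rewrite exp_Ropp, exp_ln by exact Hu0; field; lra. }
    pose proof (INR_fact_lt_0 (S m)) as Hf.
    apply Rle_div_l in E; [|exact Hf].
    apply (Rle_div_r _ _ x); [exact Hx|].
    simpl (x ^ S m) in E; nra.
  - apply filterlim_const.
  - change (Rbar_locally 0) with (locally 0).
    replace (locally 0) with (locally (INR (fact (S m)) * 0)) by (f_equal; ring).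
    apply (filterlim_comp _ _ _ (fun u => / - ln u) (fun y => INR (fact (S m)) * y) _ (locally 0)).
    + apply (filterlim_comp _ _ _ (fun u => - ln u) Rinv _ (Rbar_locally p_infty)).
      * apply (filterlim_comp _ _ _ ln Ropp _ (Rbar_locally m_infty)); [exact is_lim_ln_0|].
        apply (filterlim_Rbar_opp m_infty).
      * apply (filterlim_Rbar_inv p_infty); discriminate.
    + apply (filterlim_scal_r (INR (fact (S m))) 0).
Qed.

Lemma chord_bound (t : R) : 0 < t <= PI / 3 ->
  0 < 2 * sin (t / 2) /\ Rabs ((2 * sin (t / 2)) ^ 2) < 4.
Proof.
  intros Ht; pose proof PI_RGT_0.
  assert (0 < sin (t / 2)) by (apply sin_gt_0; lra).
  assert (0 < cos (t / 2)) by (apply cos_gt_0; lra).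
  pose proof (sin2_cos2 (t / 2)) as E; unfold Rsqr in E.
  split; [lra|]; rewrite Rabs_pos_eq; nra.
Qed.

(** Transfers limits in u = 2 sin(t/2) to limits in t. The target is the one-sided filter, since the
    limit of u (- ln u)^m is taken over positive u. *)
Lemma chord_lim : filterlim (fun t => 2 * sin (t / 2)) (at_right 0) (at_right 0).
Proof.
  intros P [d Hd]; unfold filtermap.
  assert (HPI : 0 < PI / 3) by (pose proof PI_RGT_0; lra).
  assert (Hc : at_right 0 (fun t => ball 0 d (2 * sin (t / 2)))).
  { apply filter_le_within.
    assert (C0 : continuous (fun t => 2 * sin (t / 2)) 0).
    { apply (ex_derive_continuous (V := R_NormedModule)); auto_derive; exact I. }
    apply C0; exists d; intros y.
    replace (0 / 2) with 0 by field; rewrite sin_0, Rmult_0_r; exact (fun Hy => Hy). }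
  generalize (filter_and _ _ Hc (at_right_Ioo _ _ HPI)); apply filter_imp.
  intros t [H1 H2]; apply Hd; [exact H1|apply chord_bound; lra].
Qed.

(** Since du = cos(t/2) dt, u [Q (S j)](u^2) is an antiderivative of the last factor. Each
    integration by parts therefore trades one power of the logarithm for one unit of the index of
    [Q]. *)
Lemma Q_moment (m j : nat) :
  is_RInt_gen
    (fun t => (- ln (2 * sin (t / 2))) ^ m / INR (fact m) *
              (Q j ((2 * sin (t / 2)) ^ 2) * cos (t / 2)))
    (at_right 0) (at_point (PI / 3)) (Q (S j + m) 1).
Proof.
  assert (HPI : 0 < PI / 3) by (pose proof PI_RGT_0; lra).
  (* This is what singles out pi/3: there u = 1, so ln u = 0 and the upper boundary terms vanish for
     positive powers of the logarithm. *)
  assert (H1 : 2 * sin (PI / 3 / 2) = 1).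
  { replace (PI / 3 / 2) with (PI / 6) by field; rewrite sin_PI6; field. }
  assert (Hc : forall m j t, 0 < t <= PI / 3 -> continuous
    (fun t => (- ln (2 * sin (t / 2))) ^ m / INR (fact m) *
              (Q j ((2 * sin (t / 2)) ^ 2) * cos (t / 2))) t).
  { intros m' j' t Ht; destruct (chord_bound t Ht).
    apply (ex_derive_continuous (V := R_NormedModule)); auto_derive; repeat split; try assumption.
    eexists; apply is_derive_Q; assumption. }
  assert (Hq : forall j, filterlim (fun u => Q j (u ^ 2)) (at_right 0) (locally 1)).
  { intros j'; rewrite <- (Q_0 j').
    eapply filterlim_filter_le_1; [apply filter_le_within|].
    replace (Q j' 0) with (Q j' (0 ^ 2)) by (f_equal; ring).
    apply (ex_derive_continuous (fun u => Q j' (u ^ 2))).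
    auto_derive; eexists; apply is_derive_Q; rewrite Rmult_1_r, Rmult_0_r, Rabs_R0; lra. }
  (* The index [j] stays general because the induction hypothesis is applied at [S j]. *)
  revert j; induction m as [|m IH]; intros j.
  - replace (Q (S j + 0) 1) with
      (2 * sin (PI / 3 / 2) * Q (S j) ((2 * sin (PI / 3 / 2)) ^ 2) - 0)
      by (rewrite H1, Nat.add_0_r, pow1; ring).
    apply (is_RInt_gen_at_right (fun t => 2 * sin (t / 2) * Q (S j) ((2 * sin (t / 2)) ^ 2)));
      [exact HPI| |apply Hc|].
    + intros t Ht; destruct (chord_bound t Ht) as [Hu Hu2].
      pose proof (is_derive_Q (S j) _ Hu2) as D.
      auto_derive; [repeat split; eexists; exact D|].
      change (Derive (fun x => Q (S j) x) (2 * sin (t * / 2) * (2 * sin (t * / 2) * 1)))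
        with (Derive (Q (S j)) ((2 * sin (t / 2)) ^ 2)).
      rewrite (is_derive_unique _ _ _ D), <- (Q_step j _ Hu2); simpl; unfold Rdiv; field.
    + apply (filterlim_comp _ _ _ (fun t => 2 * sin (t / 2)) (fun u => u * Q (S j) (u ^ 2))
        _ (at_right 0)); [apply chord_lim|].
      replace (locally 0) with (locally (mult 0 1)) by (f_equal; apply Rmult_0_l).
      eapply filterlim_comp_2; [|apply Hq|apply (filterlim_mult (K := R_AbsRing))].
      apply filter_le_within.
  - (* Integrate the derivative of (-ln u)^(m+1)/(m+1)! * u Q_(j+1)(u^2), which
       vanishes at both ends. *)
    replace (Q (S j + S m) 1) with (plus (0 - 0) (Q (S (S j) + m) 1))
      by (unfold plus; simpl; rewrite Nat.add_succ_r; ring).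
    eapply (is_RInt_gen_ext (V := R_NormedModule)); cycle 1.
    + eapply (is_RInt_gen_plus (V := R_NormedModule)); [|apply (IH (S j))].
      replace (0 - 0) with ((- ln (2 * sin (PI / 3 / 2))) ^ S m / INR (fact (S m)) *
        (2 * sin (PI / 3 / 2) * Q (S j) ((2 * sin (PI / 3 / 2)) ^ 2)) - 0)
        by (rewrite H1, ln_1; simpl; unfold Rdiv; ring).
      apply (is_RInt_gen_at_right (fun t => (- ln (2 * sin (t / 2))) ^ S m / INR (fact (S m)) *
        (2 * sin (t / 2) * Q (S j) ((2 * sin (t / 2)) ^ 2)))
        (fun t => (- ln (2 * sin (t / 2))) ^ S m / INR (fact (S m)) *
              (Q j ((2 * sin (t / 2)) ^ 2) * cos (t / 2)) -
              (- ln (2 * sin (t / 2))) ^ m / INR (fact m) *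
              (Q (S j) ((2 * sin (t / 2)) ^ 2) * cos (t / 2)))); [exact HPI| | |].
      * intros t Ht; destruct (chord_bound t Ht) as [Hu Hu2].
        pose proof (is_derive_Q (S j) _ Hu2) as D.
        auto_derive; [repeat split; [exact Hu|eexists; exact D]|].
        change (Derive (fun x => Q (S j) x) (2 * sin (t * / 2) * (2 * sin (t * / 2) * 1)))
        with (Derive (Q (S j)) ((2 * sin (t / 2)) ^ 2)).
        rewrite (is_derive_unique _ _ _ D), <- (Q_step j _ Hu2).
        change (match m with 0%nat => 1 | S _ => INR m + 1 end) with (INR (S m)).
        change (fact m + m * fact m)%nat with (fact (S m)).
        rewrite fact_simpl, mult_INR.
        pose proof (INR_fact_neq_0 m); pose proof (not_0_INR (S m) ltac:(lia)).
        generalize dependent (INR (S m)); intros c Hcm; simpl pow; unfold Rdiv in *.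
        field; repeat split; auto; lra.
      * intros t Ht; apply (continuous_minus (V := R_NormedModule)); apply Hc, Ht.
      * apply (filterlim_comp _ _ _ (fun t => 2 * sin (t / 2))
          (fun u => (- ln u) ^ S m / INR (fact (S m)) * (u * Q (S j) (u ^ 2)))
          _ (at_right 0)); [apply chord_lim|].
        (* Regrouped so that the first factor tends to 0 by [filterlim_mul_ln_pow] while the second
           has the finite limit 1 / (m+1)!. *)
        apply filterlim_ext with
          (fun u => (u * (- ln u) ^ S m) * (/ INR (fact (S m)) * Q (S j) (u ^ 2)));
          [intros u; unfold Rdiv; ring|].
        replace (locally 0) with (locally (mult 0 (/ INR (fact (S m)) * 1)))
          by (f_equal; apply Rmult_0_l).
        eapply filterlim_comp_2; [apply filterlim_mul_ln_pow| |apply (filterlim_mult (K := R_AbsRing))].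
        eapply filterlim_comp; [apply Hq|].
        apply (filterlim_scal_r (/ INR (fact (S m))) 1).
    + apply filter_forall; intros [x y] t _; unfold plus; simpl; ring.
Qed.

(** The case j = 0 of [Q_moment], whose weight is identically 1 by [Q0_cos]. Replacing ln by - ln
    costs (-1)^n, and the minus sign in [Ls] supplies the remaining factor -1. *)
Lemma Ls_Q (n : nat) : (-1) ^ (n + 1) / INR (fact n) * Ls (n + 1) (PI / 3) = Q (S n) 1.
Proof.
  unfold Ls; replace (n + 1 - 1)%nat with n by lia.
  pose proof (INR_fact_neq_0 n) as Hf.
  assert (Hs : (-1) ^ n * (-1) ^ n = 1).
  { rewrite <- Rpow_mult_distr; replace (-1 * -1) with 1 by ring; apply pow1. }
  rewrite (is_RInt_gen_unique (V := R_CompleteNormedModule)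
    (fun t => ln (Rabs (2 * sin (t / 2))) ^ n) ((-1) ^ n * INR (fact n) * Q (S n) 1)).
  - rewrite pow_add; simpl.
    transitivity ((-1) ^ n * (-1) ^ n * Q (S n) 1); [field; auto|rewrite Hs; ring].
  - eapply (is_RInt_gen_ext (V := R_NormedModule)); cycle 1.
    + apply (is_RInt_gen_scal (V := R_NormedModule)
        (fun t => (- ln (2 * sin (t / 2))) ^ n / INR (fact n) *
          (Q 0 ((2 * sin (t / 2)) ^ 2) * cos (t / 2))) ((-1) ^ n * INR (fact n)) (Q (S n) 1)), (Q_moment n 0).
    + apply (Filter_prod _ _ _ (fun x => 0 < x < PI / 3) (fun y => y = PI / 3)).
      * apply at_right_Ioo; pose proof PI_RGT_0; lra.
      * reflexivity.
      * intros x y Hx -> t; cbn [fst snd]; intros [Ht1 Ht2].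
        assert (HPI : 0 < PI / 3) by (pose proof PI_RGT_0; lra).
        assert (0 < t) by (revert Ht1; apply Rmin_case; lra).
        assert (t < PI / 3) by (revert Ht2; apply Rmax_case; lra).
        destruct (chord_bound t ltac:(lra)) as [Hu _].
        rewrite (Rabs_pos_eq (2 * sin (t / 2))) by lra.
        pose proof (Q0_cos t ltac:(lra)) as E; rewrite E.
        unfold scal; simpl; unfold mult; simpl.
        replace (- ln (2 * sin (t / 2))) with (-1 * ln (2 * sin (t / 2))) by ring.
        rewrite Rpow_mult_distr.
        transitivity ((-1) ^ n * (-1) ^ n * ln (2 * sin (t / 2)) ^ n);
          [field; auto|rewrite Hs; ring].
Qed.

(** * Complex series, Pochhammer symbols and hypergeometric terms *)

Lemma is_series_RtoC (a : nat -> R) (l : R) :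
  is_series a l -> is_series (fun k => RtoC (a k)) (RtoC l).
Proof.
  intros H.
  apply filterlim_ext with (fun n => RtoC (sum_n a n)).
  - induction x as [|x IH]; [now rewrite !sum_O|].
    rewrite !sum_Sn, <- IH; apply injective_projections; simpl; unfold plus; simpl; ring.
  - apply (filterlim_comp _ _ _ (sum_n a) RtoC _ (locally l)); [exact H|].
    intros P [d Hd]; exists d; intros y Hy; apply Hd; split; [exact Hy|apply ball_center].
Qed.

Lemma Cmod_series_le (a : nat -> C) (b : nat -> R) (l : C) (m : R) :
  (forall k, Cmod (a k) <= b k) -> is_series a l -> is_series b m -> Cmod l <= m.
Proof.
  intros Hab Ha Hb.
  apply (is_lim_seq_le (fun n => Cmod (sum_n a n)) (sum_n b) (Cmod l) m); [| |exact Hb].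
  - intros n; eapply Rle_trans; [apply (norm_sum_n_m (V := C_NormedModule))|].
    apply sum_n_m_le, Hab.
  - apply (filterlim_comp _ _ _ (sum_n a) Cmod _ (locally l)); [exact Ha|].
    apply (filterlim_norm (V := C_NormedModule)).
Qed.

Lemma pow_n_Cpow (s : C) (n : nat) : pow_n s n = (s ^ n)%C.
Proof. induction n as [|n IH]; [reflexivity|]; simpl; now rewrite IH. Qed.

Lemma RtoC_neq_0 (x : R) : x <> 0 -> RtoC x <> 0%C.
Proof. intros H E; apply H, RtoC_inj, E. Qed.

Lemma Re_pos_neq_0 (z : C) : 0 < Re z -> z <> 0%C.
Proof. intros H ->; simpl in H; lra. Qed.

Lemma poch_neq_0 (a : C) (k : nat) : 0 < Re a -> poch a k <> 0%C.
Proof.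
  intros Ha; induction k as [|k IH]; simpl.
  - apply Re_pos_neq_0; simpl; lra.
  - apply Cmult_neq_0; [exact IH|]; apply Re_pos_neq_0.
    destruct a; simpl in *; pose proof (pos_INR k); lra.
Qed.

(** Both sides are a (a+1) ... (a+k). *)
Lemma poch_shift (a : C) (k : nat) :
  (poch a k * (a + INR k) = poch (a + 1) k * a)%C.
Proof.
  induction k as [|k IH]; [simpl; ring|].
  cbn [poch]; rewrite IH, S_INR, RtoC_plus; ring.
Qed.

Lemma poch_ratio (a : C) (k : nat) : 0 < Re a ->
  (poch a k / poch (a + 1) k = a / (a + INR k))%C.
Proof.
  intros Ha; pose proof (pos_INR k).
  assert (H1 : poch (a + 1) k <> 0%C) by (apply poch_neq_0; destruct a; simpl in *; lra).
  assert (H2 : (a + INR k)%C <> 0%C) by (apply Re_pos_neq_0; destruct a; simpl in *; lra).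
  replace (poch a k) with (poch (a + 1) k * a / (a + INR k))%C; [field; auto|].
  rewrite <- poch_shift; field; auto.
Qed.

(** The classical (1/2)_k = (2k)! / (4^k k!), written through [cbin]. *)
Lemma poch_half (k : nat) : poch (RtoC (1 / 2)) k = RtoC (cbin k * 4 ^ k * INR (fact k)).
Proof.
  induction k as [|k IH].
  - rewrite cbin_0; simpl; f_equal; ring.
  - cbn [poch]; rewrite IH, <- RtoC_plus, <- RtoC_mult, fact_simpl, mult_INR; f_equal.
    transitivity (4 ^ k * INR (fact k) * ((INR k + 1 / 2) * cbin k)); [ring|].
    rewrite <- cbin_S; simpl (4 ^ S k); ring.
Qed.

Lemma prod_poch_repeat (a : C) (m k : nat) : prod_poch (repeat a m) k = (poch a k ^ m)%C.
Proof. induction m as [|m IH]; [reflexivity|]; simpl; now rewrite IH. Qed.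

Lemma poch_half_scaled (k : nat) :
  (poch (RtoC (1 / 2)) k * pow_n (RtoC (1 / 4)) k / INR (fact k))%C = RtoC (cbin k).
Proof.
  rewrite poch_half, pow_n_Cpow, <- RtoC_pow, <- RtoC_mult, <- RtoC_div by apply INR_fact_neq_0.
  f_equal; unfold Rdiv; rewrite Rmult_1_l, pow_inv.
  field; split; [apply INR_fact_neq_0|apply pow_nonzero; lra].
Qed.

(** Pairing n + 1 upper parameters 1/2 with the lower ones 3/2 = 1/2 + 1 gives n + 1 factors 1 /
    (2k+1) by [poch_ratio]. The one left over, with (1/4)^k / k!, gives [cbin k]. *)
Lemma hyp_term_half (n k : nat) :
  hyp_term (repeat (RtoC (1 / 2)) (n + 2)) (repeat (RtoC (3 / 2)) (n + 1)) (RtoC (1 / 4)) k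
  = RtoC (qcoef (S n) k).
Proof.
  pose proof (pos_INR k).
  unfold hyp_term, qcoef; rewrite !prod_poch_repeat.
  replace (n + 2)%nat with (S (n + 1)) by lia; rewrite Cpow_S.
  replace (RtoC (3 / 2)) with (RtoC (1 / 2) + 1)%C
    by (rewrite <- RtoC_plus; f_equal; field).
  assert (Hp : poch (RtoC (1 / 2) + 1)%C k <> 0%C) by (apply poch_neq_0; simpl; lra).
  assert (Hk : RtoC (INR (fact k)) <> 0%C) by (apply RtoC_neq_0, INR_fact_neq_0).
  transitivity (poch (RtoC (1 / 2)) k * pow_n (RtoC (1 / 4)) k / INR (fact k) *
    (poch (RtoC (1 / 2)) k / poch (RtoC (1 / 2) + 1) k) ^ (n + 1))%C.
  - unfold Cdiv; rewrite Cpow_mult_l, Cpow_inv by exact Hp; ring.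
  - rewrite poch_half_scaled, poch_ratio by (simpl; lra).
    rewrite <- RtoC_plus, <- RtoC_div, <- RtoC_pow, <- RtoC_mult by lra.
    replace (1 / 2 / (1 / 2 + INR k)) with (/ (2 * INR k + 1)) by (field; lra).
    now rewrite pow_inv, Nat.add_1_r.
Qed.

(** With a = (s+1)/2 the lower parameter is a + 1, and [poch_ratio] yields a / (a+k) = (s+1) /
    (2k+1+s). The bound on |s| gives Re s > -1, hence Re a > 0. *)
Lemma hyp_term_shift (s : C) (k : nat) : Cmod s < 1 ->
  hyp_term (RtoC (1 / 2) :: (s / RtoC 2 + RtoC (1 / 2))%C :: nil)
    ((s / RtoC 2 + RtoC (3 / 2))%C :: nil) (RtoC (1 / 4)) k
  = ((s + 1) * (RtoC (cbin k) / (RtoC (2 * INR k + 1) + s)))%C.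
Proof.
  intros Hs; pose proof (pos_INR k).
  assert (Hr : -1 < Re s).
  { pose proof (Rmax_Cmod s) as M; pose proof (Rmax_l (Rabs (fst s)) (Rabs (snd s))).
    pose proof (Rabs_maj2 (fst s)); unfold Re; lra. }
  assert (H2 : RtoC 2 <> 0%C) by (apply RtoC_neq_0; lra).
  set (a := (s / RtoC 2 + RtoC (1 / 2))%C).
  assert (Ha : a = ((s + 1) / 2)%C) by (unfold a; rewrite RtoC_div by lra; field; auto).
  assert (Hra : 0 < Re a).
  { unfold a; destruct s as [x y]; simpl in *; lra. }
  replace (s / RtoC 2 + RtoC (3 / 2))%C with (a + 1)%C
    by (unfold a; rewrite !RtoC_div by lra;
        replace (RtoC 3) with (RtoC 1 + RtoC 2)%C by (rewrite <- RtoC_plus; f_equal; ring);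
        field; auto).
  unfold hyp_term, prod_poch; simpl fold_right.
  transitivity (poch (RtoC (1 / 2)) k * pow_n (RtoC (1 / 4)) k / INR (fact k) *
    (poch a k / poch (a + 1) k))%C.
  - assert (Hp : poch (a + 1)%C k <> 0%C) by (apply poch_neq_0; destruct a; simpl in *; lra).
    assert (Hk : RtoC (INR (fact k)) <> 0%C) by (apply RtoC_neq_0, INR_fact_neq_0).
    field; auto.
  - rewrite poch_half_scaled, poch_ratio, Ha by exact Hra.
    rewrite RtoC_plus, RtoC_mult.
    assert (H3 : (RtoC 2 * INR k + 1 + s)%C <> 0%C).
    { apply Re_pos_neq_0; destruct s; simpl in *; lra. }
    field; auto.
Qed.

(** * The generating function, through a truncated geometric expansion *)

Lemma is_series_qcoef (m : nat) : is_series (qcoef m) (Q m 1).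
Proof.
  assert (H : is_pseries (qcoef m) 1 (Q m 1))
    by (apply PSeries_correct, ex_pseries_qcoef; rewrite Rabs_pos_eq; lra).
  apply is_pseries_R in H; revert H; apply is_series_ext.
  intros k; rewrite pow1; apply Rmult_1_r.
Qed.

Lemma is_series_cbin : is_series cbin (Q 0 1).
Proof.
  generalize (is_series_qcoef 0); apply is_series_ext; intros k.
  apply Rdiv_1_r.
Qed.

Lemma Cmod_shift_lower (s : C) (k : nat) : 1 - Cmod s <= Cmod (RtoC (2 * INR k + 1) + s).
Proof.
  pose proof (pos_INR k).
  pose proof (Cmod_triangle (RtoC (2 * INR k + 1) + s) (- s)) as T.
  replace (RtoC (2 * INR k + 1) + s + - s)%C with (RtoC (2 * INR k + 1)) in T by ring.
  rewrite Cmod_opp, Cmod_R, Rabs_pos_eq in T by lra; lra.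
Qed.

(** What is left of c_k / (2k+1+s) after the first [n] terms of its expansion in powers of -s /
    (2k+1). *)
Definition remainder (s : C) (n k : nat) : C :=
  ((- s / RtoC (2 * INR k + 1)) ^ n * (RtoC (cbin k) / (RtoC (2 * INR k + 1) + s)))%C.

(** Uses |s / (2k+1)| <= |s| and |2k+1+s| >= 1 - |s|. The bound separates a geometric factor in [n]
    from a summable factor in [k]. *)
Lemma Cmod_remainder (s : C) (n k : nat) : Cmod s < 1 ->
  Cmod (remainder s n k) <= Cmod s ^ n / (1 - Cmod s) * cbin k.
Proof.
  intros Hs; pose proof (pos_INR k); pose proof (cbin_pos k).
  pose proof (Cmod_shift_lower s k) as Hd; pose proof (Cmod_ge_0 s).
  unfold remainder; rewrite Cmod_mult, Cmod_pow, !Cmod_div, Cmod_opp, !Cmod_R.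
  - rewrite !Rabs_pos_eq by lra.
    replace (Cmod s ^ n / (1 - Cmod s) * cbin k)
      with (Cmod s ^ n * (cbin k / (1 - Cmod s))) by (field; lra).
    apply Rmult_le_compat.
    + apply pow_le, Rdiv_le_0_compat; lra.
    + apply Rdiv_le_0_compat; lra.
    + apply pow_incr; split; [apply Rdiv_le_0_compat; lra|].
      apply Rle_div_l; nra.
    + apply Rmult_le_compat_l; [lra|]; apply Rinv_le_contravar; lra.
  - intros E; rewrite E, Cmod_0 in Hd; lra.
  - apply RtoC_neq_0; lra.
Qed.

(** With d = 2k+1, 1/(d+s) = 1/d + (-s/d) / (d+s). The term split off is (-s)^n c_k / d^(n+1), whose
    sum over k is (-s)^n [Q (S n) 1]. *)
Lemma remainder_step (s l : C) (n : nat) : Cmod s < 1 ->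
  is_series (remainder s n) l ->
  is_series (remainder s (S n)) (l - (- s) ^ n * RtoC (Q (S n) 1))%C.
Proof.
  intros Hs Hl.
  pose proof (is_series_minus _ _ _ _ Hl
    (is_series_scal (V := C_NormedModule) ((- s) ^ n)%C _ _
      (is_series_RtoC _ _ (is_series_qcoef (S n))))) as H.
  revert H; apply is_series_ext; intros k.
  pose proof (pos_INR k); pose proof (Cmod_shift_lower s k) as Hd.
  assert (H1 : RtoC (2 * INR k + 1) <> 0%C) by (apply RtoC_neq_0; lra).
  assert (H2 : (RtoC (2 * INR k + 1) + s)%C <> 0%C)
    by (intros E; rewrite E, Cmod_0 in Hd; lra).
  change ((remainder s n k - (- s) ^ n * RtoC (qcoef (S n) k))%C = remainder s (S n) k).
  unfold remainder, qcoef, Cdiv.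
  rewrite RtoC_div by (apply pow_nonzero; lra).
  rewrite RtoC_pow, !Cpow_mult_l, !Cpow_S, Cpow_inv by exact H1.
  field; repeat split; auto; apply Cpow_nz, H1.
Qed.

Lemma generating_series (s l : C) : Cmod s < 1 ->
  is_series (fun k => RtoC (cbin k) / (RtoC (2 * INR k + 1) + s))%C l ->
  is_series (fun n => (- s) ^ n * RtoC (Q (S n) 1))%C l.
Proof.
  intros Hs Hl.
  set (t := fun n => ((- s) ^ n * RtoC (Q (S n) 1))%C).
  assert (R0 : is_series (remainder s 0) l).
  { revert Hl; apply is_series_ext; intros k; unfold remainder; simpl; symmetry; apply Cmult_1_l. }
  (* The partial sum [sum_n t n] has n + 1 terms, hence the index [S n] of the remainder. *)
  assert (RS : forall n, is_series (remainder s (S n)) (l - sum_n t n)%C).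
  { induction n as [|n IH].
    - rewrite sum_O; apply remainder_step; assumption.
    - rewrite sum_Sn.
      replace (l - plus (sum_n t n) (t (S n)))%C with (l - sum_n t n - t (S n))%C
        by (unfold plus; simpl; ring).
      apply remainder_step; assumption. }
  (* The error is itself the sum of the remainders, so its modulus is at most |s|^(n+1) / (1 - |s|)
     times [Q 0 1]. *)
  assert (Z : filterlim (fun n => (l - sum_n t n)%C) eventually (locally (zero : C_NormedModule))).
  { apply (filterlim_norm_zero (V := C_NormedModule)).
    apply (is_lim_seq_le_le (fun _ => 0) _
      (fun n => Cmod s ^ S n / (1 - Cmod s) * Q 0 1) 0).
    - intros n; split; [apply Cmod_ge_0|].
      apply (Cmod_series_le _ _ _ _ (fun k => Cmod_remainder s (S n) k Hs) (RS n)).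
      exact (is_series_scal (V := R_NormedModule) (Cmod s ^ S n / (1 - Cmod s)) cbin _ is_series_cbin).
    - apply is_lim_seq_const.
    - apply is_lim_seq_ext with (fun n => (Cmod s / (1 - Cmod s) * Q 0 1) * Cmod s ^ n);
        [intros n; simpl; unfold Rdiv; ring|].
      replace (Finite 0) with (Rbar_mult (Cmod s / (1 - Cmod s) * Q 0 1) 0)
        by (simpl; f_equal; ring).
      apply is_lim_seq_scal_l, is_lim_seq_geom.
      rewrite Rabs_pos_eq; [exact Hs|apply Cmod_ge_0]. }
  change (filterlim (sum_n t) eventually (locally l)).
  apply filterlim_ext with (fun n => plus l (opp (l - sum_n t n)%C)).
  - intros n; unfold plus, opp; simpl; ring.
  - assert (G : filterlim (fun n => plus (l : C_NormedModule) (opp (l - sum_n t n)%C)) eventually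
      (locally (plus (l : C_NormedModule) (opp zero)))).
    { eapply filterlim_comp_2;
        [apply filterlim_const| |apply (filterlim_plus (V := C_NormedModule))].
      eapply filterlim_comp; [exact Z|apply (filterlim_opp (V := C_NormedModule))]. }
    rewrite opp_zero, plus_zero_r in G; exact G.
Qed.

Theorem theorem2p11 :
  (forall n : nat,
      is_pFq (repeat (RtoC (1/2)) (n + 2)) (repeat (RtoC (3/2)) (n + 1)) (RtoC (1/4))
        (RtoC ((-1) ^ (n + 1) / INR (fact n) * Ls (n + 1) (PI / 3)))
      /\ is_series
           (fun k : nat => / 2 ^ (4 * k) / (2 * INR k + 1) ^ (n + 1) * Binomial.C (2 * k) k)
           ((-1) ^ (n + 1) / INR (fact n) * Ls (n + 1) (PI / 3)))
  /\
  (forall s : C, Cmod s < 1 ->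
     exists F : C,
       is_pFq (RtoC (1/2) :: (s / RtoC 2 + RtoC (1/2))%C :: nil)
              ((s / RtoC 2 + RtoC (3/2))%C :: nil) (RtoC (1/4)) F
       /\ is_series (fun n : nat =>
             (- RtoC (Ls (n + 1) (PI / 3)) * pow_n s n / RtoC (INR (fact n)))%C)
             (F / (s + 1))%C
       /\ is_series (fun k : nat =>
             (RtoC (/ 2 ^ (4 * k) * Binomial.C (2 * k) k)
                / (RtoC (2 * INR k + 1) + s))%C)
             (F / (s + 1))%C).
Proof.
  split.
  - intros n; rewrite Ls_Q; split.
    + unfold is_pFq; eapply is_series_ext;
        [|apply is_series_RtoC, is_series_qcoef].
      intros k; symmetry; apply hyp_term_half.
    + generalize (is_series_qcoef (S n)); apply is_series_ext; intros k.
      unfold qcoef, cbin; rewrite Nat.add_1_r; unfold Rdiv.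
      rewrite !Rmult_assoc; f_equal; apply Rmult_comm.
  - intros s Hs.
    assert (Hs1 : (s + 1)%C <> 0%C).
    { intros E; pose proof (Cmod_shift_lower s 0) as H.
      simpl INR in H; rewrite Rmult_0_r, Rplus_0_l, Cplus_comm, E, Cmod_0 in H; lra. }
    assert (exists l : C, is_series
      (fun k => RtoC (cbin k) / (RtoC (2 * INR k + 1) + s))%C l) as [l Hl].
    { apply (ex_series_le (V := C_CompleteNormedModule) _ (fun k => / (1 - Cmod s) * cbin k)).
      - intros k; pose proof (Cmod_remainder s 0 k Hs) as H; unfold remainder in H.
        simpl Cpow in H; rewrite Cmult_1_l in H; simpl pow in H; unfold Rdiv in H.
        rewrite Rmult_1_l in H; exact H.
      - eexists; exact (is_series_scal (V := R_NormedModule) (/ (1 - Cmod s)) cbin _ is_series_cbin). }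
    (* The factor s + 1 is the one that [hyp_term_shift] takes out of each hypergeometric term. *)
    exists ((s + 1) * l)%C.
    replace ((s + 1) * l / (s + 1))%C with l by (field; exact Hs1).
    split; [|split; [|exact Hl]].
    + unfold is_pFq; eapply is_series_ext;
        [|apply (is_series_scal (V := C_NormedModule) (s + 1)%C), Hl].
      intros k; symmetry; apply hyp_term_shift, Hs.
    + eapply is_series_ext; [|apply (generating_series s l Hs Hl)].
      intros n.
      change (((- s) ^ n * RtoC (Q (S n) 1))%C =
        (- RtoC (Ls (n + 1) (PI / 3)) * pow_n s n / RtoC (INR (fact n)))%C).
      rewrite <- Ls_Q, (pow_n_Cpow s n).
      pose proof (INR_fact_neq_0 n) as Hf.
      assert (Hfc : RtoC (INR (fact n)) <> 0%C) by (apply RtoC_neq_0, Hf).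
      replace (- s)%C with (RtoC (-1) * s)%C by (apply injective_projections; simpl; ring).
      rewrite Cpow_mult_l, <- RtoC_pow, RtoC_mult, RtoC_div by exact Hf.
      (* The sign of (-s)^n meets the sign in [Ls_Q]; their product -1 is the minus sign in front of
         [Ls]. *)
      assert (E : (RtoC ((-1) ^ n) * RtoC ((-1) ^ (n + 1)))%C = (- (1))%C).
      { rewrite <- RtoC_mult, <- RtoC_opp, pow_add, <- Rmult_assoc, <- Rpow_mult_distr.
        replace (-1 * -1) with 1 by ring; rewrite pow1; f_equal; ring. }
      transitivity (RtoC ((-1) ^ n) * RtoC ((-1) ^ (n + 1)) *
        (RtoC (Ls (n + 1) (PI / 3)) * s ^ n / RtoC (INR (fact n))))%C; [field; auto|].
      rewrite E; field; auto.
Qed.
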